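(* Let $k$ be a field and let $I$ be a $k$-algebra without identity. Let $K$ be a subspace of $k\ltimes_d I$. Then $K$ is an ideal of $k\ltimes_d I$ if and only if one of the following holds: (a) $K=\{(0,x)\mid x\in L\}$, where $L$ is an ideal of $I$. (b) $K=k\ltimes_d I$. (c) $K=\{(\alpha,-x)\mid \alpha\in k,\ x\in J,\ \varphi(x)=\alpha\}$, where $J$ is a subalgebra of $I$, $\varphi:J\to k$ is an algebra epimorphism, and if $\varphi(x)=\alpha$ (with $x\in J$) then for any $y\in I$ the elements $\alpha y-xy$ and $\alpha y-yx$ lie in $J$ and $\varphi(\alpha y-xy)=\varphi(\alpha y-yx)=0$.
   Context: Algebras are associative $k$-algebras, not necessarily unital; ideals are two-sided; an algebra epimorphism is a surjective algebra homomorphism. $k\ltimes_d I$ is the vector space $k\oplus I$ with multiplication $(\alpha,x)(\beta,y)=(\alpha\beta,\ \alpha y+\beta x+xy)$; it is a unital algebra with identity $(1,0)$. *)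

(* Defs.v *)
From HB Require Import structures.
From mathcomp Require Import all_boot all_order all_algebra.
From mathcomp Require Import boolp classical_sets functions.

Set Implicit Arguments.
Unset Strict Implicit.
Unset Printing Implicit Defensive.

Import GRing.Theory.

Local Open Scope classical_set_scope.
Local Open Scope ring_scope.

(* The product of ring_scope belongs to unital rings, so the product of a      *)
(* non-unital algebra is the semigroup product, written (x * y)%g.             *)
HB.mixin Record Lmodule_isNuAlgebra (R : pzRingType) A
    of GRing.Lmodule R A & Semigroup A := {
  nu_mulDl : left_distributive (@monoid.mul A) +%R;
  nu_mulDr : right_distributive (@monoid.mul A) +%R;
  nu_scaleAl : forall (a : R) (x y : A), a *: (x * y)%g = (a *: x * y)%g;
  nu_scaleAr : forall (a : R) (x y : A), a *: (x * y)%g = (x * (a *: y))%g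
}.

#[short(type="nuAlgType")]
HB.structure Definition NuAlgebra (R : pzRingType) :=
  {A of GRing.Lmodule R A & Semigroup A & Lmodule_isNuAlgebra R A}.

Section Notions.
Context {k : fieldType} {A : nuAlgType k}.

Definition is_identity (e : A) : Prop :=
  forall x : A, (e * x)%g = x /\ (x * e)%g = x.

Definition is_subspace (S : set A) : Prop := submod_closed (mem S).

Definition is_subalgebra (S : set A) : Prop :=
  is_subspace S /\ mulg_closed (mem S).

Definition is_ideal (S : set A) : Prop :=
  is_subspace S /\
  forall a x : A, S x -> S (a * x)%g /\ S (x * a)%g.

(* A map J -> k is given by a total function A -> k whose values outside J     *)
(* are never used.                                                             *)
Definition is_epi_on (J : set A) (phi : A -> k) : Prop :=
  [/\ forall c : k, {in J &, forall x y, phi (c *: x + y) = c * phi x + phi y},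
      {in J &, forall x y, phi (x * y)%g = phi x * phi y}
    & set_surj J [set: k] phi].

End Notions.

Definition dorroh (k : fieldType) (I : nuAlgType k) : Type := (k^o * I)%type.

Section Dorroh.
Context {k : fieldType} (I : nuAlgType k).

HB.instance Definition _ := GRing.Lmodule.copy (dorroh I) (k^o * I)%type.

Definition dorroh_mul (u v : dorroh I) : dorroh I :=
  (u.1 * v.1, u.1 *: v.2 + v.1 *: u.2 + (u.2 * v.2)%g).

Lemma dorroh_mulA : associative dorroh_mul.
Proof.
move=> [a x] [b y] [c z]; rewrite /dorroh_mul /=; congr (_, _).
  exact: mulrA.
rewrite !scalerDr !nu_mulDl !nu_mulDr !scalerA -!nu_scaleAl -!nu_scaleAr mulgA.
rewrite (mulrC (c : k) a) (mulrC (c : k) b) !addrA.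
by rewrite [LHS](AC (7%AC) (1*2*4*6*3*5*7)%AC).
Qed.

HB.instance Definition _ := isSemigroup.Build (dorroh I) dorroh_mulA.

Lemma dorroh_mulDl : left_distributive (@monoid.mul (dorroh I)) +%R.
Proof.
move=> [a x] [b y] [c z]; congr (_, _) => /=; first exact: mulrDl.
by rewrite scalerDl scalerDr nu_mulDl [RHS]addrACA; congr (_ + _); rewrite addrACA.
Qed.

Lemma dorroh_mulDr : right_distributive (@monoid.mul (dorroh I)) +%R.
Proof.
move=> [a x] [b y] [c z]; congr (_, _) => /=; first exact: mulrDr.
by rewrite scalerDl scalerDr nu_mulDr [RHS]addrACA; congr (_ + _); rewrite addrACA.
Qed.

Lemma dorroh_scaleAl (c : k) (u v : dorroh I) :
  c *: (u * v)%g = (c *: u * v)%g.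
Proof.
case: u v => [a x] [b y]; congr (_, _) => /=; first exact: scalerAl.
by rewrite !scalerDr -nu_scaleAl !scalerA (mulrC (b : k) c).
Qed.

Lemma dorroh_scaleAr (c : k) (u v : dorroh I) :
  c *: (u * v)%g = (u * (c *: v))%g.
Proof.
case: u v => [a x] [b y]; congr (_, _) => /=; first exact: scalerAr.
by rewrite !scalerDr -nu_scaleAr !scalerA (mulrC (a : k) c).
Qed.

HB.instance Definition _ := Lmodule_isNuAlgebra.Build k (dorroh I)
  dorroh_mulDl dorroh_mulDr dorroh_scaleAl dorroh_scaleAr.

Lemma dorroh_identity : is_identity ((1, 0) : dorroh I).
Proof.
have l0 (x : I) : (0 * x)%g = 0
  by apply: (addrI (0 * x)%g); rewrite -nu_mulDl !addr0.
have r0 (x : I) : (x * 0)%g = 0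
  by apply: (addrI (x * 0)%g); rewrite -nu_mulDr !addr0.
move=> [a x]; split; congr (_, _) => /=.
- exact: mul1r.
- by rewrite scale1r scaler0 l0 !addr0.
- exact: mulr1.
- by rewrite scale1r scaler0 r0 add0r addr0.
Qed.

End Dorroh.

(* Main.v *)
(* If K is an ideal, either every element of K has first coordinate 0, which
   is (a), or K contains two elements (a, x), (b, x) with a <> b, hence the
   identity (1, 0), which is (b), or K is the graph of a partial function
   I -> k, which up to the sign of the argument is the phi of (c).  The sign is
   what makes phi multiplicative: with (0, -y), the element (a, -x) of K has
   product (0, -(a y - x y)), so phi (a y - x y) = 0 and
   phi (x y) = phi (a y) = phi x * phi y. *)
Require Import Defs.
From HB Require Import structures.
From mathcomp Require Import all_boot all_order all_algebra.
From mathcomp Require Import boolp classical_sets functions.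

Import GRing.Theory.

Local Open Scope classical_set_scope.
Local Open Scope ring_scope.

Section NuAlgebraTheory.
Set Implicit Arguments.
Unset Strict Implicit.
Context {k : fieldType} {A : nuAlgType k}.
Implicit Types (x y : A) (S : set A).

Lemma nu_mulNr x y : (- x * y)%g = - (x * y)%g.
Proof. by rewrite -scaleN1r -nu_scaleAl scaleN1r. Qed.

Lemma nu_mulrN x y : (x * - y)%g = - (x * y)%g.
Proof. by rewrite -scaleN1r -nu_scaleAr scaleN1r. Qed.

(** Restates [submod_closed (mem S)] with plain applications of [S], so that later steps avoid
    boolean membership. *)
Lemma is_subspaceP S :
  is_subspace S <->
  S 0 /\ forall (c : k) x y, S x -> S y -> S (c *: x + y).
Proof.
split=> -[S0 Slin]; split.
- by move: S0; rewrite inE.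
- move=> c x y Sx Sy.
  by have := Slin c x y; rewrite !inE; apply.
- by rewrite inE.
- by move=> c x y; rewrite !inE; apply: Slin.
Qed.

Section Subspace.
Variables (S : set A) (Ssub : is_subspace S).

Lemma subspace0 : S 0.
Proof. by case/is_subspaceP: Ssub. Qed.

Lemma subspace_linear (c : k) x y : S x -> S y -> S (c *: x + y).
Proof. by case/is_subspaceP: Ssub => _; apply. Qed.

Lemma subspaceZ (c : k) x : S x -> S (c *: x).
Proof.
by move=> Sx; rewrite -[_ *: _]addr0; apply: subspace_linear subspace0.
Qed.

Lemma subspaceN x : S x -> S (- x).
Proof. by rewrite -scaleN1r; apply: subspaceZ. Qed.

Lemma subspaceB x y : S x -> S y -> S (x - y).
Proof. by move=> Sx Sy; rewrite addrC -scaleN1r; apply: subspace_linear. Qed.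

End Subspace.
End NuAlgebraTheory.

Section DorrohIdeals.
Set Implicit Arguments.
Unset Strict Implicit.
Context {k : fieldType} {I : nuAlgType k}.
Implicit Types (K : set (dorroh I)) (L J : set I) (phi : I -> k).

Lemma dorroh_mulE (a b : k) (x y : I) :
  (((a, x) : dorroh I) * ((b, y) : dorroh I))%g =
  ((a * b, a *: y + b *: x + (x * y)%g) : dorroh I).
Proof. by []. Qed.

(** The trace of [K] on the copy of [I] formed by the pairs [(0, x)]; it serves as the [L] of case
    (a). *)
Definition ideal_section K : set I := [set x | K (0, x)].

Lemma ideal_section_ideal K : is_ideal K -> is_ideal (ideal_section K).
Proof.
case=> Ksub Kmul; split.
  apply/is_subspaceP; split=> [|c x y Kx Ky]; first exact: (subspace0 Ksub).
  have := subspace_linear Ksub c Kx Ky.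
  by congr (K (_, _)); rewrite /= scaler0 addr0.
move=> a x /(Kmul ((0, a) : dorroh I)); rewrite /ideal_section /= !dorroh_mulE.
by rewrite !scale0r mul0r !add0r.
Qed.

Lemma ideal_of_section L K : is_subspace K -> is_ideal L ->
  K = [set u : dorroh I | exists x : I, L x /\ u = (0, x)] -> is_ideal K.
Proof.
move=> Ksub [Lsub Lmul] KE; split=> // -[b y] u.
rewrite KE => -[x [Lx ->]]; have [Lyx Lxy] := Lmul y x Lx.
rewrite !dorroh_mulE !mulr0 !mul0r !scale0r; split.
  exists (b *: x + (y * x)%g); split; last by rewrite addr0.
  exact: subspace_linear.
exists (b *: x + (x * y)%g); split; last by rewrite add0r.
exact: subspace_linear.
Qed.

(** The product of [(b, y)] and [(a, - x)] is [(b * a, - (b *: x - z))] with [z = a *: y - y * x],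
    and the product in the other order has [z = a *: y - x * y]. Since [phi z = 0], the value of
    [phi] at [b *: x - z] is [b * a]. *)
Lemma ideal_of_graph J phi K : is_subspace K -> is_subalgebra J ->
  is_epi_on J phi ->
  (forall (x : I) (a : k), J x -> phi x = a -> forall y : I,
    [/\ J (a *: y - (x * y)%g), J (a *: y - (y * x)%g),
        phi (a *: y - (x * y)%g) = 0 & phi (a *: y - (y * x)%g) = 0]) ->
  K = [set u : dorroh I | exists (a : k) (x : I),
        [/\ J x, phi x = a & u = (a, - x)]] ->
  is_ideal K.
Proof.
move=> Ksub [Jsub _] [philin _ _] Jmod KE; split=> // -[b y] u.
rewrite KE => -[a [x [Jx phix ->]]].
have [Jl Jr phil phir] := Jmod x a Jx phix y.
have graph_mem z : J z -> phi z = 0 ->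
    J (b *: x - z) /\ phi (b *: x - z) = b * a.
  move=> Jz phiz; have JNz := subspaceN Jsub Jz.
  have phiNz : phi (- z) = 0.
    (* Linearity is only known in the form [c *: x + y] on [J]: the pair [z, z] yields [phi 0 = 0],
       and the pair [z, 0] then yields [phi (- z) = 0]. *)
    have := philin (-1) z z; rewrite !inE => /(_ Jz Jz).
    have := philin (-1) z 0; rewrite !inE => /(_ Jz (subspace0 Jsub)).
    by rewrite !scaleN1r addNr addr0 phiz mulr0 addr0 => -> ->; rewrite addr0.
  split; first exact: subspace_linear.
  by have := philin b x (- z); rewrite !inE phiNz phix addr0; apply.
rewrite !dorroh_mulE; split.
- have [? ?] := graph_mem _ Jr phir.
  exists (b * a), (b *: x - (a *: y - (y * x)%g)); split=> //.
  by congr (_, _); rewrite nu_mulrN scalerN opprB [RHS]addrC addrA.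
- have [? ?] := graph_mem _ Jl phil.
  exists (b * a), (b *: x - (a *: y - (x * y)%g)); split=> //.
  by rewrite mulrC nu_mulNr scalerN opprB; congr (_, _); rewrite [LHS]addrAC.
Qed.

(** The difference of the two elements is [(a - b, 0)], an invertible multiple of the identity
    [(1, 0)]. *)
Lemma ideal_eq_setT K (a b : k) (x : I) : is_ideal K ->
  K (a, x) -> K (b, x) -> a != b -> K = [set: dorroh I].
Proof.
move=> [Ksub Kmul] Ka Kb neq_ab; apply/seteqP; split=> // u _.
have K1 : K (1, 0).
  have := subspaceZ Ksub (a - b)^-1 (subspaceB Ksub Ka Kb).
  congr (K (_, _)); last by rewrite /= subrr scaler0.
  by apply: mulVf; rewrite subr_eq0.
by have [+ _] := Kmul u _ K1; have [_ ->] := dorroh_identity u.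
Qed.

Lemma graph_of_ideal K : is_ideal K ->
  (forall a b x, K (a, x) -> K (b, x) -> a = b) ->
  (exists2 u, K u & u.1 != 0) ->
  exists (J : set I) (phi : I -> k),
    [/\ is_subalgebra J, is_epi_on J phi,
        (forall (x : I) (a : k), J x -> phi x = a -> forall y : I,
          [/\ J (a *: y - (x * y)%g), J (a *: y - (y * x)%g),
              phi (a *: y - (x * y)%g) = 0 & phi (a *: y - (y * x)%g) = 0])
      & K = [set u : dorroh I | exists (a : k) (x : I),
              [/\ J x, phi x = a & u = (a, - x)]]].
Proof.
move=> [Ksub Kmul] Kfun [[a0 x0] Ka0 /= a0_neq0].
pose J : set I := [set x | exists a, K (a, - x)].
(* On [J] the chosen scalar is the only one possible, by [Kfun]; the default 0 is taken only outside
   [J]. *)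
pose phi (x : I) : k := xget 0 [set a | K (a, - x)].
have Kphi x : J x -> K (phi x, - x).
  by case=> a Ka; apply: (@xgetPex _ 0 [set a | K (a, - x)]); exists a.
have phiE a x : K (a, - x) -> J x /\ phi x = a.
  move=> Ka; have Jx : J x by exists a.
  by split=> //; apply: Kfun (Kphi x Jx) Ka.
have Klin c x y : J x -> J y -> K (c * phi x + phi y, - (c *: x + y)).
  move=> /Kphi Kx /Kphi Ky; have := subspace_linear Ksub c Kx Ky.
  by congr (K (_, _)); rewrite /= opprD scalerN.
have K0 x a y : J x -> phi x = a ->
    K (0, - (a *: y - (x * y)%g)) /\ K (0, - (a *: y - (y * x)%g)).
  move=> /Kphi + phix; rewrite phix => Kx.
  (* The first coordinate 0 of the multiplier kills that of the product, leaving in the second only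
     the two elements required by (c), up to sign. *)
  have [Kl Kr] := Kmul ((0, - y) : dorroh I) _ Kx.
  move: Kl Kr; rewrite !dorroh_mulE mul0r mulr0 !scale0r addr0 add0r.
  rewrite !nu_mulNr !nu_mulrN !opprK scalerN !opprD !opprK.
  by move=> Kl Kr; split.
have Kprod x y : J x -> J y -> K (phi x * phi y, - (x * y)%g).
  move=> Jx Jy; have [Kd _] := K0 x _ y Jx erefl.
  (* Subtracting [(0, - (phi x *: y - x * y))] from [phi x *: (phi y, - y)] leaves
     [(phi x * phi y, - (x * y))]. *)
  have := subspaceB Ksub (subspaceZ Ksub (phi x) (Kphi _ Jy)) Kd.
  congr (K (_, _)); first by rewrite /= subr0.
  by rewrite /= scalerN opprK addrA addNr add0r.
exists J, phi; split.
- split; last first.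
    move=> x y; rewrite !inE => Jx Jy.
    by exists (phi x * phi y); apply: Kprod.
  apply/is_subspaceP; split.
    by exists 0; rewrite oppr0; apply: (subspace0 Ksub).
  by move=> c x y Jx Jy; exists (c * phi x + phi y); apply: Klin.
- split=> [c x y|x y|b _]; rewrite ?inE.
  + by move=> Jx Jy; have [] := phiE _ _ (Klin c x y Jx Jy).
  + by move=> Jx Jy; have [] := phiE _ _ (Kprod x y Jx Jy).
  (* A preimage of [b] comes from rescaling [(a0, x0)] so that its first coordinate becomes [b]. *)
  + have Kb : K (b, - (- ((b / a0) *: x0))).
      have := subspaceZ Ksub (b / a0) Ka0.
      by congr (K (_, _)); rewrite ?opprK //=; apply: divfK.
    by have [Jx phix] := phiE _ _ Kb; exists (- ((b / a0) *: x0)).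
- move=> x a Jx phix y; have [Kl Kr] := K0 x a y Jx phix.
  by have [? ?] := phiE _ _ Kl; have [? ?] := phiE _ _ Kr.
apply/seteqP; split=> [[a x] Ku | u [a [x [Jx <- ->]]]]; last exact: Kphi.
have Ka : K (a, - - x) by rewrite opprK.
by have [Jx phix] := phiE _ _ Ka; exists a, (- x); rewrite opprK.
Qed.

End DorrohIdeals.

Theorem proposition4p1 (k : fieldType) (I : nuAlgType k)
    (noid : ~ exists e : I, is_identity e)
    (K : set (dorroh I)) (Ksub : is_subspace K) :
  is_ideal K <->
  [\/ (* (a) *)
      exists L : set I, is_ideal L /\
        K = [set u : dorroh I | exists x : I, L x /\ u = (0, x)],
      (* (b) *)
      K = [set: dorroh I]
    | (* (c) *)
      exists (J : set I) (phi : I -> k),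
        [/\ is_subalgebra J,
            is_epi_on J phi,
            (forall (x : I) (a : k), J x -> phi x = a ->
              forall y : I,
                [/\ J (a *: y - (x * y)%g),
                    J (a *: y - (y * x)%g),
                    phi (a *: y - (x * y)%g) = 0
                  & phi (a *: y - (y * x)%g) = 0])
          & K = [set u : dorroh I | exists (a : k) (x : I),
                  [/\ J x, phi x = a & u = (a, - x)]]]].
Proof.
split=> [Kid|[[L [Lid KE]]|->|[J [phi [Jalg phiepi Jmod KE]]]]]; last first.
- exact: ideal_of_graph KE.
- by split=> //; apply/is_subspaceP.
- exact: ideal_of_section KE.
have [Kpos|Kzero] := pselect (exists2 u, K u & u.1 != 0); last first.
  apply: Or31; exists (ideal_section K); split.
    exact: ideal_section_ideal.
  apply/seteqP; split=> [[a x] Ku|u [x [Kx ->]]] //.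
  have a0 : a = 0 by apply: contra_notP Kzero => /eqP a0; exists (a, x).
  by exists x; rewrite /ideal_section /= -a0.
have [Kfun|] := pselect (forall a b x, K (a, x) -> K (b, x) -> a = b).
  by apply: Or33; apply: graph_of_ideal.
(* By contraposition: were [K] not the whole algebra, [ideal_eq_setT] would rule out [a != b] for
   every such pair, against [Knfun]. *)
move=> Knfun; apply: Or32; apply: contra_notP Knfun => KneqT a b x Ka Kb.
by apply/eqP; apply: contra_notT KneqT; apply: ideal_eq_setT Ka Kb.
Qed.
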